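(* Let $k$ be a local field, let $n\ge 2$, let $g\in \mathrm{GL}_n(k)$, and let $0<\epsilon<\frac14$. Write $g=k_g a_g k_g'$ for a Cartan decomposition of $g$, with $a_g=\mathrm{diag}(a_1(g),\ldots,a_n(g))$ and $|a_1(g)|\ge\cdots\ge|a_n(g)|$. (1) If $\left|\frac{a_2(g)}{a_1(g)}\right|\le \epsilon^2$, then $[g]$ is $\epsilon$-contracting. More precisely, in the definition of $\epsilon$-contracting one can take $H_g$ to be the projective hyperplane spanned by $\{k_g'^{-1}(e_i)\}_{i=2}^n$ and $v_g=[k_g(e_1)]$. (2) Conversely, suppose that $g$ is $\epsilon$-contracting. If $k$ is non-archimedean with uniformizer $\pi$, then $\left|\frac{a_2(g)}{a_1(g)}\right|\le\frac{\epsilon^2}{|\pi|}$. If $k$ is archimedean, then $\left|\frac{a_2(g)}{a_1(g)}\right|\le 4\epsilon^2$.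
   Context: $k$ is a local field with absolute value $|\cdot|$ (the usual absolute value or modulus if $k=\mathbb{R}$ or $\mathbb{C}$). Let $e_1,\ldots,e_n$ be the standard basis of $k^n$. The norm $\|\cdot\|$ on $k^n$ is the standard Euclidean norm if $k=\mathbb{R}$, the standard Hermitian norm if $k=\mathbb{C}$, and the sup norm in the standard coordinates if $k$ is non-archimedean. The exterior square $\Lambda^2 k^n$ carries the corresponding norm of the same type with respect to the basis $\{e_i\wedge e_j\}_{i<j}$. Projective space $\mathbb{P}(k^n)$ is equipped with the distance $d([u],[v])=\frac{\|u\wedge v\|}{\|u\|\,\|v\|}$ for $u,v\in k^n\setminus\{0\}$, where $[u]$ denotes the line spanned by $u$; $[g]$ denotes the projective transformation induced by $g\in\mathrm{GL}_n(k)$. For a projective hyperplane $H$ put $d(p,H)=\inf_{q\in H}d(p,q)$. An element $g\in\mathrm{GL}_n(k)$ (or $[g]$) is called $\epsilon$-contracting if there are a projective hyperplane $H_g\subset\mathbb{P}(k^n)$ and a point $v_g\in\mathbb{P}(k^n)$ such that $[g]$ maps the complement of the $\epsilon$-neighborhood of $H_g$ into the $\epsilon$-ball around $v_g$, i.e. for every $p\in\mathbb{P}(k^n)$ with $d(p,H_g)\ge\epsilon$ one has $d([g]p,v_g)\le\epsilon$. Cartan decomposition: let $K$ be the compact subgroup of $\mathrm{GL}_n(k)$ preserving the norm $\|\cdot\|$ on $k^n$ ($O(n)$ if $k=\mathbb{R}$, $U(n)$ if $k=\mathbb{C}$, $\mathrm{GL}_n$ of the ring of integers if $k$ is non-archimedean).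 Every $g\in\mathrm{GL}_n(k)$ can be written as $g=k_g a_g k_g'$ with $k_g,k_g'\in K$ and $a_g=\mathrm{diag}(a_1(g),\ldots,a_n(g))$ diagonal with $|a_1(g)|\ge\cdots\ge|a_n(g)|$; when $k=\mathbb{R}$ or $\mathbb{C}$ the $a_i(g)$ are taken real and positive (the singular values of $g$). The absolute values $|a_i(g)|$ depend only on $g$. *)

(* Defs.v *)
(* The real numbers are an arbitrary [R : realType], the complex numbers are
   [R[i]]. *)
From mathcomp Require Import all_boot all_order all_algebra.
From mathcomp Require Import complex.
From mathcomp Require Import classical_sets reals.

Set Implicit Arguments.
Unset Strict Implicit.
Unset Printing Implicit Defensive.

Import Order.TTheory GRing.Theory Num.Theory.

Local Open Scope ring_scope.

(* A generator of the maximal ideal {|x| < 1} of the ring {|x| <= 1}. *)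
Definition uniformizer_for (R : realType) (F : fieldType) (abs : F -> R)
    (pi : F) : Prop :=
  pi != 0 /\
  (forall x : F, abs x < 1 <-> exists2 y : F, abs y <= 1 & x = y * pi).

(* Non-archimedean local field: complete for a non-trivial discrete absolute
   value, with finite residue field. Non-triviality is part of [na_discrete]
   since a uniformizer is nonzero. No normalization of |pi| is imposed. *)
Record nonarchField (R : realType) := NonarchField {
  na_sort :> fieldType;
  na_abs : na_sort -> R;
  na_abs_ge0 : forall x, 0 <= na_abs x;
  na_abs_eq0 : forall x, na_abs x = 0 <-> x = 0;
  na_absM : forall x y, na_abs (x * y) = na_abs x * na_abs y;
  na_ultrametric : forall x y,
    na_abs (x + y) <= Num.max (na_abs x) (na_abs y);
  na_discrete : exists pi, uniformizer_for na_abs pi;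
  na_complete : forall u : nat -> na_sort,
    (forall e : R, 0 < e -> exists N : nat, forall i j : nat,
       (N <= i)%N -> (N <= j)%N -> na_abs (u i - u j) < e) ->
    exists l : na_sort, forall e : R, 0 < e -> exists N : nat,
      forall i : nat, (N <= i)%N -> na_abs (u i - l) < e;
  na_residue_finite : exists s : seq na_sort, forall x,
    na_abs x <= 1 -> exists2 y, y \in s & na_abs (x - y) < 1
}.

(* Local fields, by their classification: the reals, the complex numbers, or
   a non-archimedean local field (of any characteristic). *)
Variant localField (R : realType) :=
  | RealLF
  | ComplexLF
  | NonarchLF of nonarchField R.
Arguments RealLF {R}.
Arguments ComplexLF {R}.

Definition lf_sort (R : realType) (k : localField R) : fieldType :=
  match k with
  | RealLF => R : fieldType
  | ComplexLF => R[i] : fieldType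
  | NonarchLF F => na_sort F
  end.
Coercion lf_sort : localField >-> fieldType.

Definition archimedean (R : realType) (k : localField R) : Prop :=
  if k is NonarchLF _ then False else True.

Definition lf_abs (R : realType) (k : localField R) : k -> R :=
  match k return lf_sort k -> R with
  | RealLF => fun x : R => `|x|
  | ComplexLF => fun z : R[i] => ComplexField.Normc.normc z
  | NonarchLF F => @na_abs R F
  end.

(* On [R[i]], [0 < z] means that z is real and positive. The predicate is only
   used for archimedean k; the last branch is a filler. *)
Definition real_positive (R : realType) (k : localField R) : k -> Prop :=
  match k return lf_sort k -> Prop with
  | RealLF => fun x : R => 0 < x
  | ComplexLF => fun z : R[i] => 0 < z
  | NonarchLF F => fun _ => False
  end.

Definition uniformizer (R : realType) (k : localField R) (pi : k) : Prop :=
  uniformizer_for (@lf_abs R k) pi.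

(* The standard norm of a vector given by its coordinates in a basis indexed
   by [I]: Euclidean, Hermitian or sup, according to [k]. *)
Definition coord_norm (R : realType) (k : localField R) (I : finType)
    (x : I -> k) : R :=
  if k is NonarchLF _ then \big[Num.max/0]_(i : I) lf_abs (x i)
  else Num.sqrt (\sum_(i : I) lf_abs (x i) ^+ 2).

Definition vnorm (R : realType) (k : localField R) (n : nat)
    (u : 'cV[k]_n) : R :=
  coord_norm (fun i : 'I_n => u i 0).

(* Index set of the basis e_i /\ e_j (i < j) of the exterior square of k^n;
   elements of the exterior square are families of coordinates in it. *)
Definition ext2_index (n : nat) : finType :=
  {p : 'I_n * 'I_n | (p.1 < p.2)%N}.

Definition wedge (F : fieldType) (n : nat) (u v : 'cV[F]_n) :
    {ffun ext2_index n -> F} :=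
  [ffun p => u (val p).1 0 * v (val p).2 0 - u (val p).2 0 * v (val p).1 0].

Definition ext2_norm (R : realType) (k : localField R) (n : nat)
    (w : {ffun ext2_index n -> k}) : R :=
  coord_norm w.

(* Points and hyperplanes of P(k^n) are the linear subspaces of k^n of
   dimension 1 and n - 1; incidence is inclusion. *)
Definition proj_point (F : fieldType) (n : nat) (p : {vspace 'cV[F]_n}) : bool :=
  \dim p == 1%N.

Definition proj_hyperplane (F : fieldType) (n : nat)
    (H : {vspace 'cV[F]_n}) : bool :=
  \dim H == n.-1.

(* [vpick p] is a nonzero vector of p; see [proj_dist_line] for independence
   of this choice. *)
Definition proj_dist (R : realType) (k : localField R) (n : nat)
    (p q : {vspace 'cV[k]_n}) : R :=
  ext2_norm (wedge (vpick p) (vpick q)) / (vnorm (vpick p) * vnorm (vpick q)).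

Definition proj_dist_hyperplane (R : realType) (k : localField R) (n : nat)
    (p H : {vspace 'cV[k]_n}) : R :=
  inf [set r : R | exists q : {vspace 'cV[k]_n},
         [/\ proj_point q, (q <= H)%VS & r = proj_dist p q]]%classic.

Definition proj_act (F : fieldType) (n : nat) (g : 'M[F]_n)
    (p : {vspace 'cV[F]_n}) : {vspace 'cV[F]_n} :=
  (linfun (mulmx g : 'cV[F]_n -> 'cV[F]_n) @: p)%VS.

Definition contracting_with (R : realType) (k : localField R) (n : nat)
    (eps : R) (g : 'M[k]_n) (H v : {vspace 'cV[k]_n}) : Prop :=
  [/\ proj_hyperplane H, proj_point v &
      forall p : {vspace 'cV[k]_n}, proj_point p ->
        eps <= proj_dist_hyperplane p H -> proj_dist (proj_act g p) v <= eps].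

Definition contracting (R : realType) (k : localField R) (n : nat)
    (eps : R) (g : 'M[k]_n) : Prop :=
  exists H v : {vspace 'cV[k]_n}, contracting_with eps g H v.

(* The subgroup K of GL_n(k) preserving the norm. *)
Definition norm_preserving (R : realType) (k : localField R) (n : nat)
    (h : 'M[k]_n) : Prop :=
  h \in unitmx /\ (forall u : 'cV[k]_n, vnorm (h *m u) = vnorm u).

Definition cartan_decomposition (R : realType) (k : localField R) (n : nat)
    (g kg : 'M[k]_n) (a : 'rV[k]_n) (kg' : 'M[k]_n) : Prop :=
  [/\ norm_preserving kg,
      norm_preserving kg',
      g = kg *m diag_mx a *m kg',
      (forall i j : 'I_n, (i <= j)%N -> lf_abs (a 0 j) <= lf_abs (a 0 i)) &
      (archimedean k -> forall i : 'I_n, real_positive (a 0 i))].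

Definition std_basis (F : fieldType) (n : nat) (i : 'I_n) : 'cV[F]_n :=
  delta_mx i 0.
Arguments std_basis {F n} i.

Lemma lf_abs_ge0 (R : realType) (k : localField R) (x : k) : 0 <= lf_abs x.
Proof.
case: k x => [x|z|F x] /=; [exact: normr_ge0 | | exact: na_abs_ge0].
by case: z => a b; rewrite /= sqrtr_ge0.
Qed.

Lemma lf_absM (R : realType) (k : localField R) (x y : k) :
  lf_abs (x * y) = lf_abs x * lf_abs y.
Proof.
by case: k x y => [x y|x y|F x y] /=;
  rewrite ?normrM ?ComplexField.Normc.normcM ?na_absM.
Qed.

Lemma lf_abs_eq0 (R : realType) (k : localField R) (x : k) :
  lf_abs x = 0 -> x = 0.
Proof.
case: k x => [x|x|F x] /=; first by move/eqP; rewrite normr_eq0 => /eqP.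
  exact: ComplexField.Normc.eq0_normc.
by move/na_abs_eq0.
Qed.

Lemma coord_normZ (R : realType) (k : localField R) (I : finType)
    (c : k) (x y : I -> k) :
  (forall i, y i = c * x i) -> coord_norm y = lf_abs c * coord_norm x.
Proof.
move=> yE.
have absE i : lf_abs (y i) = lf_abs c * lf_abs (x i) by rewrite yE lf_absM.
have c0 := lf_abs_ge0 c.
have sqrtE : Num.sqrt (\sum_(i : I) lf_abs (y i) ^+ 2)
    = lf_abs c * Num.sqrt (\sum_(i : I) lf_abs (x i) ^+ 2).
  under eq_bigr do rewrite absE exprMn.
  by rewrite -mulr_sumr sqrtrM ?sqr_ge0// sqrtr_sqr ger0_norm.
have maxE : \big[Num.max/0]_(i : I) lf_abs (y i)
    = lf_abs c * \big[Num.max/0]_(i : I) lf_abs (x i).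
  under eq_bigr do rewrite absE.
  rewrite (big_morph (fun t => lf_abs c * t) (id1 := 0) (op1 := Num.max))//.
    by move=> s t; rewrite maxr_pMr.
  by rewrite mulr0.
by case: k c x y {yE absE c0} sqrtE maxE.
Qed.

Lemma proj_dist_line (R : realType) (k : localField R) (n : nat)
    (u v : 'cV[k]_n) : u != 0 -> v != 0 ->
  proj_dist <[u]>%VS <[v]>%VS = ext2_norm (wedge u v) / (vnorm u * vnorm v).
Proof.
have pickE (w : 'cV[k]_n) : w != 0 ->
    exists2 c, c != 0 & vpick <[w]>%VS = c *: w.
  move=> w0; have /vlineP[c cE] := memv_pick <[w]>%VS; exists c => //.
  apply: contra_neq w0 => c0; apply/eqP.
  by rewrite -memv0 -[in X in _ \in X](_ : <[w]> = 0)%VS ?memv_line//;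
    apply/eqP; rewrite -vpick0 cE c0 scale0r.
move=> /pickE[c c0 uE] /pickE[d d0 vE]; rewrite /proj_dist uE vE.
have lf0 (x : k) : x != 0 -> lf_abs x != 0.
  by apply: contra_neq; apply: lf_abs_eq0.
have wedgeE : ext2_norm (wedge (c *: u) (d *: v))
    = lf_abs (c * d) * ext2_norm (wedge u v).
  apply: coord_normZ => i.
  by rewrite !ffunE !mxE mulrBr !(mulrACA c _ d).
have vnormZ (b : k) (w : 'cV[k]_n) : vnorm (b *: w) = lf_abs b * vnorm w.
  by apply: coord_normZ => i; rewrite mxE.
rewrite wedgeE !vnormZ lf_absM (mulrACA (lf_abs c)) -mulf_div.
by rewrite divff ?mul1r// mulf_neq0 ?lf0.
Qed.

Lemma proj_act_line (F : fieldType) (n : nat) (g : 'M[F]_n) (u : 'cV[F]_n) :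
  proj_act g <[u]>%VS = <[g *m u]>%VS.
Proof. by rewrite /proj_act limg_line lfunE. Qed.

(* Main.v *)
Require Import Defs.
From mathcomp Require Import all_boot all_order all_algebra.
From mathcomp Require Import complex.
From mathcomp Require Import classical_sets reals.
From mathcomp Require Import ring lra.

(** The projective distance has one description for all local fields: since
the norm of a bivector [u /\ v] is [|v|] times the distance from [u] to the
line of [v] ([wedge_norm_le], [wedge_norm_attained]), the number [d([u], [v])]
is the least value of [|u - c v| / |u|] over the scalars [c].  Norms of
vectors are then all that matters, and elements of K drop out by definition;
the proof may pretend that [g] is the diagonal matrix with entries [a_i].

If [|a_2| <= eps^2 |a_1|], let [u] be at distance at least [eps] from the
coordinate hyperplane spanned by the other basis vectors.  Subtracting from
[u] its first component gives a vector of that hyperplane, so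
[|u_1| >= eps |u|].  Then [g u] differs from [a_1 u_1 e_1] by at most
[|a_2| |u| <= eps^2 |a_1| |u| <= eps |a_1 u_1| <= eps |g u|].

Conversely, let [g] contract the complement of a neighbourhood of [H] into a
ball around [v].  Duality turns both subspaces into unit linear forms: [f]
vanishing on [H], and [phi] in the span of the first two coordinates,
vanishing on [v].  Contraction becomes the numerical implication
[|f(u)| >= eps |u|] implies [|phi(g u)| <= eps |g u|]
([diagonal_dual_forms]).  Let [fs] be a unit vector with [f(fs) = 1].  For
every basis vector [e_i] there is a scalar [s] of size about [eps] such that
[u = e_i + s fs] satisfies the hypothesis; as [g fs] has norm at most [|a_1|]
and [|phi(g fs)| <= eps |a_1|], this gives, up to constants,
[|phi_i| |a_i| <= eps |a_i| + eps^2 |a_1|].  For [i = 1] the estimate says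
that [phi_1] is small, so that [phi_2], the other coordinate of a unit form, is
not; for [i = 2] it then bounds [|a_2|] by a multiple of [eps^2 |a_1|].  In the
archimedean case [|s| = 11/10 eps] is enough ([perturbation_arch]), and the
constant is 4.  In the ultrametric case [s] is 0 or a power of the uniformizer
with [eps <= |s| < eps / |pi|] ([perturbation_nonarch]), and the strong triangle
inequality gives [|a_2| <= eps |s| |a_1|]. *)

Set Implicit Arguments.
Unset Strict Implicit.
Unset Printing Implicit Defensive.

Import Order.TTheory GRing.Theory Num.Theory.
Local Open Scope ring_scope.

(** * Absolute values *)

Section AbsoluteValue.
Variables (R : realType) (k : localField R).
Implicit Types x y : k.

Lemma lf_abs0 : lf_abs (0 : k) = 0.
Proof.
case: k => [||F] /=; [exact: normr0 | exact: ComplexField.Normc.normc0 |].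
by apply/na_abs_eq0.
Qed.

Lemma lf_abs_eq0E x : (lf_abs x == 0) = (x == 0).
Proof.
by apply/eqP/eqP => [/lf_abs_eq0|->]; last exact: lf_abs0.
Qed.

Lemma lf_abs_gt0 x : (0 < lf_abs x) = (x != 0).
Proof. by rewrite lt_neqAle lf_abs_ge0 andbT eq_sym lf_abs_eq0E. Qed.

Lemma lf_abs1 : lf_abs (1 : k) = 1.
Proof.
have n0 : lf_abs (1 : k) != 0 by rewrite lf_abs_eq0E oner_eq0.
by apply: (mulfI n0); rewrite -lf_absM !mulr1.
Qed.

Lemma lf_absN x : lf_abs (- x) = lf_abs x.
Proof.
suff n1 : lf_abs (-1 : k) = 1 by rewrite -mulN1r lf_absM n1 mul1r.
have /eqP : lf_abs (-1 : k) ^+ 2 = 1.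
  by rewrite expr2 -lf_absM mulrNN mulr1 lf_abs1.
by rewrite sqrf_eq1 => /orP[/eqP//|/eqP n1]; have := lf_abs_ge0 (-1 : k); lra.
Qed.

Lemma lf_absV x : lf_abs x^-1 = (lf_abs x)^-1.
Proof.
have [->|x0] := eqVneq x 0; first by rewrite invr0 lf_abs0 invr0.
have n0 : lf_abs x != 0 by rewrite lf_abs_eq0E.
by apply: (mulfI n0); rewrite -lf_absM !divff // lf_abs1.
Qed.

Lemma lf_absX x m : lf_abs (x ^+ m) = lf_abs x ^+ m.
Proof.
by elim: m => [|m IH]; rewrite ?expr0 ?lf_abs1 // !exprS lf_absM IH.
Qed.

Lemma lf_absB_max : ~ archimedean k ->
  forall x y, lf_abs (x - y) <= Num.max (lf_abs x) (lf_abs y).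
Proof.
move=> na x y; rewrite -[lf_abs y]lf_absN.
by case: k na x y => [[]|[]|F] //= _ x y; apply: na_ultrametric.
Qed.

Lemma lf_absD x y : lf_abs (x + y) <= lf_abs x + lf_abs y.
Proof.
case: k x y => [||F] x y /=; [exact: ler_normD | exact: le_normcD |].
apply: le_trans (na_ultrametric _ _) _.
by rewrite ge_max lerDl lerDr !na_abs_ge0.
Qed.

Lemma lf_absB x y : lf_abs (x - y) <= lf_abs x + lf_abs y.
Proof. by rewrite -[lf_abs y]lf_absN lf_absD. Qed.

Lemma lf_abs_sum (I : finType) (F : I -> k) :
  lf_abs (\sum_i F i) <= \sum_i lf_abs (F i).
Proof.
elim/big_rec2: _ => [|i y x _ le_xy]; first by rewrite lf_abs0.
by apply: le_trans (lf_absD _ _) _; rewrite lerD2l.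
Qed.

(** The two archimedean fields are handled together through this structure: a
conjugation [cj] and an embedding [r] of the reals with [|x|^2 = x * cj x]. *)
Lemma archimedean_conj : archimedean k ->
  exists (cj : {rmorphism k -> k}) (r : {rmorphism R -> k}),
    [/\ involutive cj, forall x, r (lf_abs x ^+ 2) = x * cj x &
        forall t, 0 <= t -> lf_abs (r t) = t].
Proof.
case: k => [||F] //= _.
  exists (@idfun R), (@idfun R); split=> //= [x|t t0].
    by rewrite real_normK ?num_real // expr2.
  exact: ger0_norm.
exists (@conjc R), (@real_complex R); split => [x|x|t t0].
- exact: conjcK.
- rewrite -sqr_normc rmorphXn /= normc_def.
  by case: x.
- by rewrite /= expr0n addr0 sqrtr_sqr ger0_norm.
Qed.

Lemma archimedean_dec : archimedean k \/ ~ archimedean k.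
Proof. by case: k => [||F]; [left|left|right]. Qed.

End AbsoluteValue.

(** * Coordinate norms *)

Section CoordNorm.
Variables (R : realType) (k : localField R) (I : finType).
Implicit Types x y : I -> k.

Lemma coord_norm_arch x : archimedean k ->
  coord_norm x = Num.sqrt (\sum_i lf_abs (x i) ^+ 2).
Proof. by case: k x. Qed.

Lemma coord_norm_arch_sqr x : archimedean k ->
  coord_norm x ^+ 2 = \sum_i lf_abs (x i) ^+ 2.
Proof.
by move=> ar; rewrite coord_norm_arch// sqr_sqrtr// sumr_ge0// => i _; exact: sqr_ge0.
Qed.

Lemma coord_norm_nonarch x : ~ archimedean k ->
  coord_norm x = \big[Num.max/0]_i lf_abs (x i).
Proof. by case: k x => [? []|? []|]. Qed.

Lemma coord_norm_ge0 x : 0 <= coord_norm x.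
Proof.
have [ar|na] := archimedean_dec k.
  by rewrite coord_norm_arch ?sqrtr_ge0.
by rewrite coord_norm_nonarch//; apply: bigmax_ge_id.
Qed.

Lemma abs_le_coord_norm x i : lf_abs (x i) <= coord_norm x.
Proof.
have [ar|na] := archimedean_dec k.
  rewrite -(ler_pXn2r (n:=2)) ?nnegrE ?lf_abs_ge0 ?coord_norm_ge0//.
  rewrite coord_norm_arch_sqr// (bigD1 i)//= lerDl sumr_ge0// => j _.
  exact: sqr_ge0.
by rewrite coord_norm_nonarch//; apply: le_bigmax.
Qed.

Lemma coord_norm_nonarch_le x b : ~ archimedean k -> 0 <= b ->
  (forall i, lf_abs (x i) <= b) -> coord_norm x <= b.
Proof.
by move=> na b0 xb; rewrite coord_norm_nonarch//; apply: bigmax_le.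
Qed.

Lemma coord_norm_nonarch_attained x : ~ archimedean k -> 0 < coord_norm x ->
  exists i, coord_norm x = lf_abs (x i).
Proof.
move=> na; rewrite coord_norm_nonarch//.
elim/big_ind: _ => [|s t IHs IHt|i _ _]; first by rewrite ltxx.
  by rewrite /Num.max; case: ifP.
by exists i.
Qed.

Lemma le_coord_norm x y b : 0 <= b ->
  (forall i, lf_abs (x i) <= b * lf_abs (y i)) -> coord_norm x <= b * coord_norm y.
Proof.
move=> b0 xy; have [ar|na] := archimedean_dec k.
  rewrite -(ler_pXn2r (n:=2)) ?nnegrE ?mulr_ge0 ?coord_norm_ge0//.
  rewrite exprMn !coord_norm_arch_sqr// mulr_sumr ler_sum// => i _.
  rewrite -exprMn ler_pXn2r ?nnegrE ?mulr_ge0 ?lf_abs_ge0//.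
apply: coord_norm_nonarch_le => // [|i]; first by rewrite mulr_ge0 ?coord_norm_ge0.
by apply: le_trans (xy i) _; rewrite ler_wpM2l// abs_le_coord_norm.
Qed.

Lemma coord_norm_eq0 x : coord_norm x = 0 -> forall i, x i = 0.
Proof.
move=> x0 i; apply: lf_abs_eq0; apply/eqP.
by rewrite eq_le lf_abs_ge0 -x0 abs_le_coord_norm.
Qed.

Lemma coord_norm0 x : (forall i, x i = 0) -> coord_norm x = 0.
Proof.
move=> x0; rewrite (@coord_normZ _ _ _ 0 x x) ?lf_abs0 ?mul0r// => i.
by rewrite x0 mul0r.
Qed.

(** Cauchy-Schwarz, read off from a nonnegative sum of squares. *)
Lemma sqr_sum_mul_le (s t : I -> R) :
  (\sum_i s i * t i) ^+ 2 <= (\sum_i s i ^+ 2) * (\sum_i t i ^+ 2).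
Proof.
set A := \sum_i s i ^+ 2; set B := \sum_i t i ^+ 2; set C := \sum_i s i * t i.
have A0 : 0 <= A by rewrite sumr_ge0// => i _; exact: sqr_ge0.
have [A00|An0] := eqVneq A 0.
  have s0 i : s i = 0.
    apply/eqP; rewrite -sqrf_eq0; move/eqP: A00.
    by rewrite psumr_eq0 => [/allP/(_ i)|j _]; rewrite ?mem_index_enum ?sqr_ge0//; apply.
  by rewrite /C big1 ?A00 ?expr0n ?mul0r// => i _; rewrite s0 mul0r.
have : 0 <= \sum_i (A * t i - C * s i) ^+ 2.
  by rewrite sumr_ge0// => i _; exact: sqr_ge0.
have -> : \sum_i (A * t i - C * s i) ^+ 2 = A * (A * B - C ^+ 2).
  under eq_bigr => i _.
    have -> : (A * t i - C * s i) ^+ 2 =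
        A ^+ 2 * t i ^+ 2 + - (2 * A * C) * (s i * t i) + C ^+ 2 * s i ^+ 2 by ring.
    over.
  by rewrite !big_split/= -!mulr_sumr -/A -/B -/C; ring.
by rewrite pmulr_rge0 ?subr_ge0// lt_neqAle eq_sym An0.
Qed.

(** Each of the three norms is at least its own dual norm.  This is why the
norm of a linear form can be taken to be that of its coefficient vector. *)
Lemma abs_pairing_le x y :
  lf_abs (\sum_i x i * y i) <= coord_norm x * coord_norm y.
Proof.
have [ar|na] := archimedean_dec k.
  apply: le_trans (lf_abs_sum _) _.
  rewrite -(ler_pXn2r (n:=2)) ?nnegrE ?mulr_ge0 ?coord_norm_ge0//; last first.
    by rewrite sumr_ge0// => i _; exact: lf_abs_ge0.
  rewrite exprMn !coord_norm_arch_sqr//.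
  by under eq_bigr do rewrite lf_absM; exact: sqr_sum_mul_le.
elim/big_ind: _ => [|s t Hs Ht|i _]; first by rewrite lf_abs0 mulr_ge0 ?coord_norm_ge0.
  rewrite -[t]opprK; apply: le_trans (lf_absB_max na _ _) _.
  by rewrite lf_absN ge_max Hs.
by rewrite lf_absM ler_pM ?lf_abs_ge0 ?abs_le_coord_norm.
Qed.

Lemma coord_normD x y z : (forall i, z i = x i + y i) ->
  coord_norm z <= coord_norm x + coord_norm y.
Proof.
move=> zE; have [ar|na] := archimedean_dec k.
  rewrite -(ler_pXn2r (n:=2)) ?nnegrE ?addr_ge0 ?coord_norm_ge0//.
  rewrite sqrrD !coord_norm_arch_sqr//.
  have cs : \sum_i lf_abs (x i) * lf_abs (y i) <= coord_norm x * coord_norm y.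
    rewrite -(ler_pXn2r (n:=2)) ?nnegrE ?mulr_ge0 ?coord_norm_ge0//; last first.
      by rewrite sumr_ge0// => i _; rewrite mulr_ge0 ?lf_abs_ge0.
    by rewrite exprMn !coord_norm_arch_sqr//; exact: sqr_sum_mul_le.
  apply: (@le_trans _ _ (\sum_i (lf_abs (x i) + lf_abs (y i)) ^+ 2)).
    apply: ler_sum => i _; rewrite ler_pXn2r ?nnegrE ?addr_ge0 ?lf_abs_ge0//.
    by rewrite zE lf_absD.
  under eq_bigr do rewrite sqrrD; rewrite !big_split/= lerD2r lerD2l.
  by rewrite -mulr2n lerMn2r.
apply: coord_norm_nonarch_le => // [|i]; first by rewrite addr_ge0 ?coord_norm_ge0.
by rewrite zE (le_trans (lf_absD _ _))// lerD ?abs_le_coord_norm.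
Qed.

(** The values of the norm are absolute values of scalars: every nonnegative
real is one over an archimedean field, and the sup norm is attained at a
coordinate. *)
Lemma coord_normalize x : coord_norm x != 0 ->
  exists c : k, lf_abs c * coord_norm x = 1.
Proof.
move=> x0; have [ar|na] := archimedean_dec k.
  have [cj [r [_ _ r_abs]]] := archimedean_conj ar.
  exists (r (coord_norm x)^-1).
  by rewrite r_abs ?invr_ge0 ?coord_norm_ge0// mulVf.
have [|i xi] := @coord_norm_nonarch_attained x na.
  by rewrite lt_neqAle eq_sym x0 coord_norm_ge0.
by exists (x i)^-1; rewrite lf_absV -xi mulVf.
Qed.

End CoordNorm.

(** * Norms of vectors *)

Section VectorNorm.
Variables (R : realType) (k : localField R) (n : nat).
Implicit Types x y : 'cV[k]_n.

Lemma vnorm_ge0 x : 0 <= vnorm x.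
Proof. exact: coord_norm_ge0. Qed.

Lemma vnorm_eq0 x : (vnorm x == 0) = (x == 0).
Proof.
apply/eqP/eqP => [x0|->]; last by apply: coord_norm0 => i; rewrite mxE.
apply/matrixP => i j; rewrite ord1 mxE.
exact: (coord_norm_eq0 x0 i).
Qed.

Lemma vnorm_gt0 x : (0 < vnorm x) = (x != 0).
Proof. by rewrite lt_neqAle vnorm_ge0 andbT eq_sym vnorm_eq0. Qed.

Lemma vnormZ (c : k) x : vnorm (c *: x) = lf_abs c * vnorm x.
Proof. by apply: coord_normZ => i; rewrite mxE. Qed.

Lemma vnormD x y : vnorm (x + y) <= vnorm x + vnorm y.
Proof. by apply: coord_normD => i; rewrite mxE. Qed.

Lemma abs_le_vnorm x i : lf_abs (x i 0) <= vnorm x.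
Proof. exact: (abs_le_coord_norm (fun i => x i 0)). Qed.

Lemma vnormD_max : ~ archimedean k ->
  forall x y, vnorm (x + y) <= Num.max (vnorm x) (vnorm y).
Proof.
move=> na x y; apply: coord_norm_nonarch_le => // [|i].
  by rewrite le_max vnorm_ge0.
rewrite mxE -[y i 0]opprK; apply: le_trans (lf_absB_max na _ _) _.
by rewrite lf_absN ge_max !le_max !abs_le_vnorm ?orbT.
Qed.

Lemma vnorm_std_basis i : vnorm (std_basis i : 'cV[k]_n) = 1.
Proof.
have E j : lf_abs ((std_basis i : 'cV[k]_n) j 0) = (j == i)%:R.
  by rewrite mxE andbT; case: (j == i); rewrite ?lf_abs1 ?lf_abs0.
apply/eqP; rewrite eq_le; apply/andP; split; last first.
  by apply: le_trans (abs_le_vnorm _ i); rewrite E eqxx.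
have [ar|na] := archimedean_dec k.
  rewrite -(ler_pXn2r (n:=2)) ?nnegrE ?vnorm_ge0// coord_norm_arch_sqr//.
  by rewrite (bigD1 i)//= E eqxx big1 ?addr0// => j ji; rewrite E (negPf ji) expr0n.
by apply: coord_norm_nonarch_le => // j; rewrite E lern1 leq_b1.
Qed.

End VectorNorm.

(** * The norm of a bivector is a distance to a line *)

(** A sum over the basis of the exterior square is half of a sum over all pairs
of indices, where double sums can be multiplied out. *)
Lemma big_ext2 (V : zmodType) (n : nat) (F : 'I_n -> 'I_n -> V) :
  (forall i j, F i j = F j i) -> (forall i, F i i = 0) ->
  \sum_i \sum_j F i j = (\sum_(p : ext2_index n) F (val p).1 (val p).2) *+ 2.
Proof.
move=> Fsym Fdiag.
rewrite -(big_sub [pred p : 'I_n * 'I_n | (p.1 < p.2)%N] (fun p => F p.1 p.2)).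
rewrite pair_big/= (bigID (fun p : 'I_n * 'I_n => (p.1 < p.2)%N))/= mulr2n.
congr (_ + _).
rewrite (bigID (fun p : 'I_n * 'I_n => p.1 == p.2))/= big1 ?add0r; last first.
  by case=> i j /= /andP[_ /eqP->].
rewrite (reindex_inj (h := fun p : 'I_n * 'I_n => (p.2, p.1))); last first.
  by case=> i j [i' j'] [-> ->].
apply: eq_big => [[i j]|[i j] _] /=; last exact: Fsym.
by rewrite inE/= -leqNgt ltn_neqAle andbC eq_sym.
Qed.

Section WedgeNorm.
Variables (R : realType) (k : localField R) (n : nat).
Implicit Types x y : 'cV[k]_n.

Lemma wedge_subZ (c : k) x y : wedge (x - c *: y) y = wedge x y.
Proof. by apply/ffunP => p; rewrite !ffunE !mxE; ring. Qed.

(** The subtracted sum is the Hermitian product of [x] and [y]; after the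
embedding [r] both sides are polynomials in the coordinates and their
conjugates, and only double sums have to be compared. *)
Lemma lagrange_identity (cj : {rmorphism k -> k}) (r : {rmorphism R -> k}) :
    archimedean k -> involutive cj ->
    (forall x : k, r (lf_abs x ^+ 2) = x * cj x) ->
  forall x y, ext2_norm (wedge x y) ^+ 2 =
    vnorm x ^+ 2 * vnorm y ^+ 2 - lf_abs (\sum_i x i 0 * cj (y i 0)) ^+ 2.
Proof.
move=> ar cjK r_abs x y; rewrite !coord_norm_arch_sqr//.
set D := \sum_i _ * _.
pose w i j := x i 0 * y j 0 - x j 0 * y i 0.
have -> : \sum_p lf_abs (wedge x y p) ^+ 2 =
    \sum_(p : ext2_index n) lf_abs (w (val p).1 (val p).2) ^+ 2.
  by apply: eq_bigr => p _; rewrite ffunE.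
apply: (fmorph_inj r); apply/eqP.
have r2 : (2 : k) != 0.
  by rewrite -(rmorph_nat r 2) fmorph_eq0 pnatr_eq0.
rewrite -(inj_eq (mulfI r2)) !mulr_natl -rmorphMn/=.
rewrite -(@big_ext2 _ _ (fun i j => lf_abs (w i j) ^+ 2)); first last.
- by move=> i; rewrite /w subrr lf_abs0 expr0n.
- by move=> i j; rewrite /w -lf_absN opprB.
rewrite rmorphB rmorphM/= r_abs.
rewrite !rmorph_sum/=; under eq_bigr do rewrite rmorph_sum/=.
under eq_bigr do under eq_bigr do rewrite r_abs.
under [\sum_i r (lf_abs (x i 0) ^+ 2)]eq_bigr do rewrite r_abs.
under [\sum_i r (lf_abs (y i 0) ^+ 2)]eq_bigr do rewrite r_abs.
apply/eqP.
under [\sum_i cj _]eq_bigr do rewrite rmorphM/= cjK mulrC.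
rewrite mulrnBl [_ *+ 2]mulr2n [(D * _) *+ 2]mulr2n.
rewrite {1}[(\sum_i x i 0 * _) * _]mulrC {1}[D * _]mulrC /D.
rewrite !big_distrlr/=.
rewrite opprD -!sumrN -!big_split/=; apply: eq_bigr => i _.
rewrite -!sumrN -!big_split/=; apply: eq_bigr => j _.
by rewrite /w rmorphB !rmorphM/=; ring.
Qed.

Lemma wedge_norm_le_mul x y : ext2_norm (wedge x y) <= vnorm x * vnorm y.
Proof.
have [ar|na] := archimedean_dec k.
  have [cj [r [cjK r_abs _]]] := archimedean_conj ar.
  rewrite -(ler_pXn2r (n:=2)) ?nnegrE ?mulr_ge0 ?coord_norm_ge0//.
  by rewrite exprMn (lagrange_identity ar cjK r_abs) gerBl sqr_ge0.
apply: coord_norm_nonarch_le => // [|p]; first by rewrite mulr_ge0 ?vnorm_ge0.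
rewrite ffunE (le_trans (lf_absB_max na _ _))// ge_max !lf_absM.
by rewrite !ler_pM ?lf_abs_ge0 ?abs_le_vnorm.
Qed.

Lemma wedge_norm_le x y (c : k) :
  ext2_norm (wedge x y) <= vnorm (x - c *: y) * vnorm y.
Proof. by rewrite -(wedge_subZ c) wedge_norm_le_mul. Qed.

(** The optimal [c] is the coefficient of the orthogonal projection of [x] on [y]
over an archimedean field, where Lagrange's identity loses its last term.  Over
an ultrametric field it is the one cancelling the coordinate [m] at which [y]
is largest: the bivector then has the coordinates [z_j y_m] of [z = x - c y]
among its own. *)
Lemma wedge_norm_attained x y : y != 0 ->
  exists c : k, ext2_norm (wedge x y) = vnorm (x - c *: y) * vnorm y.
Proof.
move=> y0; have [ar|na] := archimedean_dec k.
  have [cj [r [cjK r_abs _]]] := archimedean_conj ar.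
  pose D := \sum_i x i 0 * cj (y i 0).
  have Y0 : r (vnorm y ^+ 2) != 0 by rewrite fmorph_eq0 sqrf_eq0 vnorm_eq0.
  exists (D / r (vnorm y ^+ 2)); apply/eqP.
  set c := D / _.
  rewrite -(eqrXn2 (n := 2)) ?mulr_ge0 ?coord_norm_ge0//.
  rewrite -(wedge_subZ c) (lagrange_identity ar cjK r_abs) exprMn.
  suff -> : \sum_i (x - c *: y) i 0 * cj (y i 0) = 0.
    by rewrite lf_abs0 expr0n subr0.
  under eq_bigr do rewrite !mxE mulrBl -mulrA -r_abs.
  rewrite sumrB -mulr_sumr -(rmorph_sum r)/= -/D.
  by rewrite -(coord_norm_arch_sqr (fun i => y i 0) ar) mulfVK ?subrr.
have [|m ym] := @coord_norm_nonarch_attained _ _ _ (fun i => y i 0) na.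
  by rewrite -/(vnorm y) vnorm_gt0.
have ym0 : y m 0 != 0 by rewrite -lf_abs_eq0E -ym -/(vnorm y) vnorm_eq0.
exists (x m 0 / y m 0); set c := _ / _.
apply/eqP; rewrite eq_le wedge_norm_le/= -(wedge_subZ c).
set z := x - c *: y.
have zm : z m 0 = 0 by rewrite !mxE mulfVK// subrr.
rewrite mulrC; have -> : vnorm y = lf_abs (y m 0) by [].
rewrite -vnormZ; apply: coord_norm_nonarch_le => // [|j]; first exact: coord_norm_ge0.
rewrite mxE.
have [jm|mj|/val_inj ->] := ltngtP j m.
- have := abs_le_coord_norm (wedge z y) (exist _ (j, m) jm).
  by rewrite ffunE/= zm mul0r subr0 mulrC.
- have := abs_le_coord_norm (wedge z y) (exist _ (m, j) mj).
  by rewrite ffunE/= zm mul0r sub0r lf_absN mulrC.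
- by rewrite zm mulr0 lf_abs0 coord_norm_ge0.
Qed.

End WedgeNorm.

(** * Projective distance *)

Section ProjectiveDistance.
Variables (R : realType) (k : localField R) (n : nat).
Implicit Types (u v : 'cV[k]_n) (p H : {vspace 'cV[k]_n}).

Lemma proj_point_line p : proj_point p -> exists2 u, u != 0 & p = <[u]>%VS.
Proof.
move=> /eqP p1; have p0 : vpick p != 0.
  by rewrite vpick0; apply/eqP => p0; move: p1; rewrite p0 dimv0.
exists (vpick p) => //; apply/esym/eqP.
by rewrite eqEdim -memvE memv_pick p1 dim_vline p0.
Qed.

Lemma line_proj_point u : u != 0 -> proj_point <[u]>%VS.
Proof. by move=> u0; rewrite /proj_point dim_vline u0. Qed.

Lemma proj_dist_le u v (c : k) : u != 0 -> v != 0 ->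
  proj_dist <[u]>%VS <[v]>%VS <= vnorm (u - c *: v) / vnorm u.
Proof.
move=> u0 v0; rewrite proj_dist_line// ler_pdivrMr ?mulr_gt0 ?vnorm_gt0//.
by rewrite mulrA divfK ?vnorm_eq0// wedge_norm_le.
Qed.

Lemma proj_dist_attained u v : u != 0 -> v != 0 ->
  exists c : k, proj_dist <[u]>%VS <[v]>%VS = vnorm (u - c *: v) / vnorm u.
Proof.
move=> u0 v0; have [c cE] := wedge_norm_attained u v0; exists c.
by rewrite proj_dist_line// cE -mulf_div divff ?mulr1// vnorm_eq0.
Qed.

Lemma proj_dist_ge0 p q : 0 <= @proj_dist R k n p q.
Proof. by rewrite divr_ge0 ?mulr_ge0 ?coord_norm_ge0. Qed.

Lemma proj_dist_hyperplane_le u v H : u != 0 -> v != 0 -> v \in H ->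
  proj_dist_hyperplane <[u]>%VS H <= vnorm (u - v) / vnorm u.
Proof.
move=> u0 v0 vH.
apply: (@le_trans _ _ (proj_dist <[u]>%VS <[v]>%VS)); last first.
  by rewrite -[v in u - v]scale1r proj_dist_le.
apply: ge_inf; last by exists <[v]>%VS; split; rewrite ?line_proj_point -?memvE.
by exists 0 => _ [q [_ _ ->]]; exact: proj_dist_ge0.
Qed.

(** A zero [H] has no points, and the infimum of the empty set is 0; hence the
assumption on [H]. *)
Lemma le_proj_dist_hyperplane u H (b : R) : u != 0 -> H != 0%VS ->
  (forall v, v \in H -> b * vnorm u <= vnorm (u - v)) ->
  b <= proj_dist_hyperplane <[u]>%VS H.
Proof.
move=> u0 H0 far; apply: lb_le_inf.
  exists (proj_dist <[u]>%VS <[vpick H]>%VS), <[vpick H]>%VS.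
  by split; rewrite ?line_proj_point ?vpick0 -?memvE ?memv_pick.
move=> _ [_ [/proj_point_line[v v0 ->] vH ->]].
have [c ->] := proj_dist_attained u0 v0.
by rewrite ler_pdivlMr ?vnorm_gt0// far// memvZ// memvE.
Qed.

End ProjectiveDistance.

(** * Linear forms *)

(** Linear forms are given by their coefficient vectors, so that the norm of a
form is that of its vector. *)
Definition dot (F : fieldType) (n : nat) (f u : 'cV[F]_n) : F :=
  (f^T *m u) 0 0.

Section LinearForms.
Variables (F : fieldType) (n : nat).
Implicit Types f u v : 'cV[F]_n.

Lemma dotE f u : dot f u = \sum_i f i 0 * u i 0.
Proof. by rewrite /dot mxE; apply: eq_bigr => i _; rewrite mxE. Qed.

Lemma dotDr f u v : dot f (u + v) = dot f u + dot f v.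
Proof. by rewrite /dot mulmxDr mxE. Qed.

Lemma dotZr f (c : F) u : dot f (c *: u) = c * dot f u.
Proof. by rewrite /dot -scalemxAr mxE. Qed.

Lemma dotBr f u v : dot f (u - v) = dot f u - dot f v.
Proof. by rewrite /dot mulmxBr !mxE. Qed.

Lemma dotBl f g u : dot (f - g) u = dot f u - dot g u.
Proof. by rewrite !dotE -sumrB; apply: eq_bigr => i _; rewrite !mxE mulrBl. Qed.

Lemma dotZl f (c : F) u : dot (c *: f) u = c * dot f u.
Proof. by rewrite /dot linearZ/= -scalemxAl mxE. Qed.

Lemma dot_mulmx f (g : 'M_n) u : dot f (g *m u) = dot (g^T *m f) u.
Proof. by rewrite /dot trmx_mul trmxK mulmxA. Qed.

Lemma dot_std_basis f i : dot f (std_basis i) = f i 0.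
Proof.
rewrite dotE (bigD1 i)//= mxE !eqxx mulr1 big1 ?addr0// => j ji.
by rewrite mxE (negPf ji) mulr0.
Qed.

(** A matrix whose columns are a basis of [H] has rank less than [n], hence a
nonzero row vector in its left kernel. *)
Lemma hyperplane_form (H : {vspace 'cV[F]_n}) : (\dim H < n)%N ->
  exists2 f, f != 0 & forall v, v \in H -> dot f v = 0.
Proof.
move=> Hn; pose B := \matrix_(i < n, j < \dim H) ((vbasis H)`_j : 'cV[F]_n) i 0.
have kB : kermx B != 0.
  by rewrite kermx_eq0 /row_free neq_ltn (leq_ltn_trans (rank_leq_col B)).
exists (nz_row (kermx B))^T.
  by rewrite -[0]trmx0 (inj_eq trmx_inj) nz_row_eq0.
move=> v /coord_vbasis ->.
have zero : nz_row (kermx B) *m B = 0.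
  by apply/eqP; rewrite -sub_kermx nz_row_sub.
rewrite /dot trmxK mulmx_sumr summxE big1// => j _.
rewrite -scalemxAr mxE; suff -> : (nz_row (kermx B) *m (vbasis H)`_j) 0 0 = 0.
  by rewrite mulr0.
have /matrixP/(_ 0 j) := zero; rewrite mxE [RHS]mxE => <-.
by rewrite mxE; apply: eq_bigr => i _; rewrite [B i j]mxE.
Qed.

End LinearForms.

Section NormedForms.
Variables (R : realType) (k : localField R) (n : nat).
Implicit Types f u v w : 'cV[k]_n.

Lemma abs_dot_le f u : lf_abs (dot f u) <= vnorm f * vnorm u.
Proof. by rewrite dotE; apply: (abs_pairing_le (fun i => f i 0) (fun i => u i 0)). Qed.

Lemma vnorm_normalize f : f != 0 -> exists c : k, vnorm (c *: f) = 1.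
Proof.
rewrite -vnorm_eq0 => f0; have [c cE] := coord_normalize f0.
by exists c; rewrite vnormZ.
Qed.

(** The vector is the conjugate of [f] over an archimedean field, and a multiple
of the basis vector at a largest coordinate of [f] over an ultrametric one. *)
Lemma dual_vector f : vnorm f = 1 -> exists2 u, vnorm u = 1 & dot f u = 1.
Proof.
move=> f1; have [ar|na] := archimedean_dec k.
  have [cj [r [cjK r_abs _]]] := archimedean_conj ar.
  have abs_cj (x : k) : lf_abs (cj x) = lf_abs x.
    apply/eqP; rewrite -(eqrXn2 (n := 2)) ?lf_abs_ge0//.
    by rewrite -(inj_eq (fmorph_inj r)) !r_abs cjK mulrC.
  exists (\col_i cj (f i 0)).
    rewrite -f1 /vnorm !coord_norm_arch//; congr Num.sqrt.
    by apply: eq_bigr => i _; rewrite mxE abs_cj.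
  rewrite dotE; under eq_bigr do rewrite mxE -r_abs.
  rewrite -rmorph_sum/= -(coord_norm_arch_sqr (fun i => f i 0) ar).
  by rewrite -/(vnorm f) f1 expr1n rmorph1.
have [|m fm] := @coord_norm_nonarch_attained _ _ _ (fun i => f i 0) na.
  by rewrite -/(vnorm f) f1.
have fm1 : lf_abs (f m 0) = 1 by rewrite -fm.
exists ((f m 0)^-1 *: std_basis m).
  by rewrite vnormZ vnorm_std_basis lf_absV fm1 invr1 mulr1.
by rewrite dotZr dot_std_basis mulVf// -lf_abs_eq0E fm1 oner_eq0.
Qed.

(** Contraction in terms of vectors: the hypothesis says that the line of [u] is
at distance at least [eps] from the kernel of [f], the conclusion that the line
of [g u] is within [eps] of that of [w].  Keeping [f] out of the inequalities
lets this property be transported by isometries ([cartan_contracting_form])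
without choosing a normalization of [f]. *)
Definition contracting_form (eps : R) (g : 'M[k]_n) f w : Prop :=
  forall u, (forall v, dot f v = 0 -> eps * vnorm u <= vnorm (u - v)) ->
  exists c : k, vnorm (g *m u - c *: w) <= eps * vnorm (g *m u).

Lemma contracting_exists_form (eps : R) (g : 'M[k]_n) :
    (2 <= n)%N -> g \in unitmx -> contracting eps g ->
  exists f w, f != 0 /\ contracting_form eps g f w.
Proof.
move=> n2 gU [H [_ [/eqP dH /proj_point_line[w w0 ->] gP]]].
have Hn : (\dim H < n)%N by rewrite dH prednK// (ltnW n2).
have H0 : H != 0%VS by rewrite -dimv_eq0 dH -lt0n -ltnS prednK// (ltnW n2).
have [f f0 fH] := hyperplane_form Hn.
exists f, w; split=> // u far.
have [->|u0] := eqVneq u 0.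
  exists 0; rewrite mulmx0 scale0r subr0.
  by have /eqP -> : vnorm (0 : 'cV[k]_n) == 0; rewrite ?vnorm_eq0 ?mulr0.
have gu0 : g *m u != 0.
  by apply: contra_neq u0 => gu0; rewrite -(mulKmx gU u) gu0 mulmx0.
have := gP _ (line_proj_point u0).
rewrite proj_act_line.
have [c ->] := proj_dist_attained gu0 w0.
rewrite ler_pdivrMr ?vnorm_gt0// => near; exists c; apply: near.
by apply: le_proj_dist_hyperplane => // v /fH; exact: far.
Qed.

(** The forms supported on two coordinates are a plane, on which vanishing at [w]
is a single linear condition. *)
Lemma orthogonal_form2 (i1 i2 : 'I_n) w : i1 != i2 ->
  exists f, [/\ vnorm f = 1, dot f w = 0 &
    forall j, j != i1 -> j != i2 -> f j 0 = 0].
Proof.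
move=> i12.
suff [f [f0 fw fj]] : exists f, [/\ f != 0, dot f w = 0 &
    forall j, j != i1 -> j != i2 -> f j 0 = 0].
  have [c cf] := vnorm_normalize f0.
  exists (c *: f); split=> [||j j1 j2] //; first by rewrite dotZl fw mulr0.
  by rewrite mxE fj ?mulr0.
have dot_e i : dot (std_basis i) w = w i 0.
  by rewrite dotE (bigD1 i)//= mxE !eqxx mul1r big1 ?addr0// => j ji;
    rewrite mxE (negPf ji) mul0r.
have [w1|w1] := eqVneq (w i1 0) 0.
  exists (std_basis i1); split=> [||j j1 j2].
  - by rewrite -(vnorm_eq0 (std_basis i1)) vnorm_std_basis oner_eq0.
  - by rewrite dot_e.
  - by rewrite mxE (negPf j1).
exists (w i2 0 *: std_basis i1 - w i1 0 *: std_basis i2); split=> [||j j1 j2].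
- apply/eqP => /matrixP/(_ i2 0) /eqP.
  by rewrite !mxE !eqxx [i2 == i1]eq_sym (negPf i12) mulr0 mulr1 sub0r oppr_eq0 (negPf w1).
- by rewrite dotBl !dotZl !dot_e; ring.
- by rewrite !mxE (negPf j1) (negPf j2) !mulr0 subr0.
Qed.

End NormedForms.

(** * The Cartan decomposition *)

Section Cartan.
Variables (R : realType) (k : localField R) (n : nat).
Implicit Types (u v w f : 'cV[k]_n) (a : 'rV[k]_n) (h : 'M[k]_n).

Lemma norm_preserving_inv h u :
  norm_preserving h -> vnorm (invmx h *m u) = vnorm u.
Proof. by case=> hU hN; rewrite -hN mulKVmx. Qed.

Lemma diag_mulE a u i : (diag_mx a *m u) i 0 = a 0 i * u i 0.
Proof. by rewrite mul_diag_mx mxE. Qed.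

Lemma diag_mul_std_basis a i : diag_mx a *m std_basis i = a 0 i *: std_basis i.
Proof.
apply/matrixP => j l; rewrite ord1 diag_mulE !mxE.
by have [->//|] := eqVneq j i; rewrite !mulr0.
Qed.

Lemma vnorm_diag_le a u (b : R) : 0 <= b -> (forall i, lf_abs (a 0 i) <= b) ->
  vnorm (diag_mx a *m u) <= b * vnorm u.
Proof.
move=> b0 ab; apply: le_coord_norm => // i.
by rewrite diag_mulE lf_absM ler_wpM2r ?lf_abs_ge0.
Qed.

Lemma cartan_diag_neq0 (g kg kg' : 'M[k]_n) a : g \in unitmx ->
  cartan_decomposition g kg a kg' -> forall i, a 0 i != 0.
Proof.
move=> gU [_ _ gE _ _] i; move: gU; rewrite gE !unitmx_mul => /andP[/andP[_ aU] _].
by move: aU; rewrite unitmxE det_diag unitfE => /prodf_neq0; apply.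
Qed.

Lemma cartan_contracting_form (eps : R) (g kg kg' : 'M[k]_n) a f w :
    cartan_decomposition g kg a kg' -> contracting_form eps g f w ->
  contracting_form eps (diag_mx a) ((invmx kg')^T *m f) (invmx kg *m w).
Proof.
move=> [kgN kgN' gE _ _] gP u far.
have [kU kN] := kgN; have [kU' kN'] := kgN'.
have gu : g *m (invmx kg' *m u) = kg *m (diag_mx a *m u).
  by rewrite gE -!mulmxA mulKVmx.
have [v fv|c] := gP (invmx kg' *m u).
  rewrite norm_preserving_inv// (le_trans (far (kg' *m v) _))//.
    by rewrite -dot_mulmx mulKmx.
  by rewrite -[u in leLHS](mulKVmx kU') -mulmxBr kN'.
by rewrite gu kN => near; exists c; rewrite -kN mulmxBr -scalemxAr mulKVmx.
Qed.

End Cartan.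

(** * Small singular ratio implies contraction *)

Section CoordinateHyperplane.
Variables (F : fieldType) (n : nat) (h : 'M[F]_n).
Hypothesis hU : h \in unitmx.

Let coordinate_hyperplane : {vspace 'cV[F]_n} :=
  <<[seq h *m std_basis i | i : 'I_n <- enum 'I_n & (0 < i)%N]>>%VS.

Lemma mem_coordinate_hyperplane (v : 'cV[F]_n) :
    (forall i : 'I_n, i = 0%N :> nat -> v i 0 = 0) ->
  h *m v \in coordinate_hyperplane.
Proof.
move=> v0; rewrite [v]matrix_sum_delta mulmx_sumr.
apply: memv_suml => i _; rewrite big_ord_recl big_ord0 addr0.
have [i0|i0] := posnP i; first by rewrite v0// scale0r mulmx0 mem0v.
rewrite -scalemxAr memvZ// memv_span//; apply/mapP; exists i => //.
by rewrite mem_filter i0 mem_enum.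
Qed.

(** All the [h e_i] span the whole space, so they form a basis; the coordinate
hyperplane is spanned by what is left when the first one is dropped. *)
Lemma coordinate_hyperplane_proj : (0 < n)%N ->
  proj_hyperplane coordinate_hyperplane.
Proof.
move=> n0.
have : free [seq h *m (std_basis i : 'cV[F]_n) | i : 'I_n <- enum 'I_n].
  set X := map _ _; have sX : size X = n by rewrite size_map size_enum_ord.
  rewrite /free sX; have -> : <<X>>%VS = fullv; last by rewrite dimvf /dim/= muln1.
  apply/eqP; rewrite eqEsubv subvf/=; apply/subvP => v _.
  rewrite -(mulKVmx hU v) [invmx h *m v]matrix_sum_delta mulmx_sumr.
  apply: memv_suml => i _; rewrite big_ord_recl big_ord0 addr0.
  by rewrite -scalemxAr memvZ// memv_span//; apply/mapP; exists i; rewrite ?mem_enum.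
rewrite /proj_hyperplane /coordinate_hyperplane.
case: n n0 h => // m _ h'.
rewrite enum_ordSl/= free_cons => /andP[_].
rewrite filter_map/= (eq_filter (a2 := predT)) ?filter_predT//.
by rewrite /free => /eqP ->; rewrite 2!size_map size_enum_ord.
Qed.

End CoordinateHyperplane.

Lemma cartan_contracting_with (R : realType) (k : localField R) (n : nat)
    (hn : (2 <= n)%N) (g : 'M[k]_n) (eps : R) (kg : 'M[k]_n) (a : 'rV[k]_n)
    (kg' : 'M[k]_n) :
  let i1 : 'I_n := Ordinal (ltnW hn) in
  let i2 : 'I_n := Ordinal hn in
  g \in unitmx -> 0 < eps -> cartan_decomposition g kg a kg' ->
  lf_abs (a 0 i2 / a 0 i1) <= eps ^+ 2 ->
  contracting_with eps g
    <<[seq invmx kg' *m std_basis i | i : 'I_n <- enum 'I_n & (0 < i)%N]>>%VS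
    <[kg *m std_basis i1]>%VS.
Proof.
move=> i1 i2 gU eps0 cartan ratio.
have a0 := cartan_diag_neq0 gU cartan.
have [[kU kN] kgN' gE a_mono _] := cartan; have [kU' kN'] := kgN'.
have e10 : kg *m (std_basis i1 : 'cV[k]_n) != 0.
  by rewrite -vnorm_eq0 kN vnorm_std_basis oner_eq0.
split; [|exact: line_proj_point|].
  by apply: coordinate_hyperplane_proj; rewrite ?unitmx_inv// ltnW.
move=> _ /proj_point_line[u u0 ->] far; rewrite proj_act_line.
have gu0 : g *m u != 0.
  by apply: contra_neq u0 => gu0; rewrite -(mulKmx gU u) gu0 mulmx0.
pose y := kg' *m u; pose w := y - y i1 0 *: std_basis i1.
have uE : u = invmx kg' *m y by rewrite mulKmx.
have w1 : w i1 0 = 0 by rewrite !mxE !eqxx mulr1 subrr.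
have wj j : j != i1 -> w j 0 = y j 0 by rewrite !mxE => /negPf ->; rewrite mulr0 subr0.
have guE : g *m u = kg *m (diag_mx a *m y) by rewrite gE -!mulmxA.
apply: le_trans (proj_dist_le (a 0 i1 * y i1 0) gu0 e10) _.
rewrite ler_pdivrMr ?vnorm_gt0// guE kN scalemxAr -mulmxBr kN.
have -> : diag_mx a *m y - (a 0 i1 * y i1 0) *: std_basis i1 = diag_mx a *m w.
  by rewrite mulmxBr -scalemxAr diag_mul_std_basis scalerA [y i1 0 * _]mulrC.
(* [w] has to span a point of the hyperplane; otherwise [g u] is a multiple of
   [kg e_1]. *)
have [->|w0] := eqVneq w 0.
  rewrite mulmx0; have /eqP -> : vnorm (0 : 'cV[k]_n) == 0 by rewrite vnorm_eq0.
  by rewrite mulr_ge0 ?vnorm_ge0// ltW.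
have y1_big : eps * vnorm y <= lf_abs (y i1 0).
  have wH : invmx kg' *m w \in
      <<[seq invmx kg' *m std_basis i | i : 'I_n <- enum 'I_n & (0 < i)%N]>>%VS.
    apply: mem_coordinate_hyperplane => i i0.
    by rewrite (_ : i = i1) //; apply: val_inj.
  have w0' : invmx kg' *m w != 0 by rewrite -vnorm_eq0 norm_preserving_inv// vnorm_eq0.
  have := le_trans far (proj_dist_hyperplane_le u0 w0' wH).
  rewrite ler_pdivlMr ?vnorm_gt0// uE -mulmxBr !norm_preserving_inv//.
  by rewrite /w subKr vnormZ vnorm_std_basis mulr1.
have ratio' : lf_abs (a 0 i2) <= eps ^+ 2 * lf_abs (a 0 i1).
  by rewrite -ler_pdivrMr ?lf_abs_gt0// -lf_absV -lf_absM.
have Dw : vnorm (diag_mx a *m w) <= lf_abs (a 0 i2) * vnorm y.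
  apply: le_coord_norm => [|j]; first exact: lf_abs_ge0.
  rewrite diag_mulE lf_absM; have [->|j1] := eqVneq j i1.
    by rewrite w1 lf_abs0 mulr0 mulr_ge0 ?lf_abs_ge0.
  rewrite wj// ler_wpM2r ?lf_abs_ge0// a_mono//=.
  by rewrite lt0n; apply: contraNneq j1 => j0; apply/eqP/val_inj.
have Dy : lf_abs (a 0 i1) * lf_abs (y i1 0) <= vnorm (diag_mx a *m y).
  by rewrite -lf_absM -diag_mulE abs_le_vnorm.
apply: le_trans Dw _.
apply: (@le_trans _ _ (eps * (lf_abs (a 0 i1) * (eps * vnorm y)))).
  have -> : eps * (lf_abs (a 0 i1) * (eps * vnorm y)) =
    eps ^+ 2 * lf_abs (a 0 i1) * vnorm y by ring.
  by rewrite ler_wpM2r ?vnorm_ge0.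
rewrite ler_wpM2l ?(ltW eps0)//; apply: le_trans Dy.
by rewrite ler_wpM2l ?lf_abs_ge0.
Qed.

(** * Contraction implies small singular ratio *)

Section Perturbation.
Variables (R : realType) (k : localField R) (n : nat) (eps : R).
Implicit Types (e f fs u : 'cV[k]_n).

(** One of the values [11/10 eps] and [- 11/10 eps] of [s] works.  By the
parallelogram law for the scalars and for the vectors, the sum over both signs of
[|f(e + s fs)|^2 - eps^2 |e + s fs|^2] is at least [2 (s^2 - eps^2 (1 + s^2))],
which is nonnegative because [s^2 (1 - eps^2) >= (121/100) (15/16) eps^2]. *)
Lemma perturbation_arch f e fs : archimedean k -> 0 < eps -> eps < 4^-1 ->
    vnorm e = 1 -> vnorm fs = 1 -> dot f fs = 1 ->
  exists2 s : k, lf_abs s <= 11 / 10 * eps &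
    eps * vnorm (e + s *: fs) <= lf_abs (dot f (e + s *: fs)).
Proof.
move=> ar eps0 eps1 e1 fs1 ffs.
have [cj [r [cjK r_abs abs_r]]] := archimedean_conj ar.
have parallelogram (x y : k) :
    lf_abs (x + y) ^+ 2 + lf_abs (x - y) ^+ 2 = 2 * lf_abs x ^+ 2 + 2 * lf_abs y ^+ 2.
  apply: (fmorph_inj r); rewrite !mulr_natl !mulr2n !rmorphD/= !r_abs.
  by rewrite rmorphB rmorphD/=; ring.
have vparallelogram u v : vnorm (u + v) ^+ 2 + vnorm (u - v) ^+ 2 =
    2 * vnorm u ^+ 2 + 2 * vnorm v ^+ 2.
  rewrite !coord_norm_arch_sqr// !mulr_sumr -!big_split/=.
  by apply: eq_bigr => i _; rewrite !mxE parallelogram.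
pose t := 11 / 10 * eps; have t0 : 0 <= t by rewrite /t; lra.
have rt : lf_abs (r t) = t := abs_r t t0.
have := vparallelogram e (r t *: fs); have := parallelogram (dot f e) (r t).
rewrite vnormZ e1 fs1 rt mulr1 expr1n mulr1.
have -> : dot f e + r t = dot f (e + r t *: fs) by rewrite dotDr dotZr ffs mulr1.
have -> : dot f e - r t = dot f (e - r t *: fs) by rewrite dotBr dotZr ffs mulr1.
set P := lf_abs _; set Q := lf_abs _; set Z := lf_abs _.
set U := vnorm _; set V := vnorm _ => PQ UV.
have good (x y : R) : 0 <= x -> 0 <= y -> eps ^+ 2 * y ^+ 2 <= x ^+ 2 -> eps * y <= x.
  by move=> x0 y0; rewrite -exprMn ler_pXn2r ?nnegrE// mulr_ge0 // ltW.
have [ge|lt] := lerP (eps ^+ 2 * U ^+ 2) (P ^+ 2).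
  exists (r t); first by rewrite rt.
  by apply: good => //; [exact: lf_abs_ge0|exact: vnorm_ge0].
exists (- r t); first by rewrite lf_absN rt.
rewrite scaleNr; apply: good; [exact: lf_abs_ge0|exact: vnorm_ge0|].
rewrite -/Q -/V.
have Z0 : 0 <= Z ^+ 2 by exact: sqr_ge0.
have eps2 : eps ^+ 2 <= 4^-1 ^+ 2 by rewrite !expr2 ler_pM// ltW.
have tE : t ^+ 2 = 121 / 100 * eps ^+ 2 by rewrite /t; field.
have e20 : 0 <= eps ^+ 2 by exact: sqr_ge0.
have : eps ^+ 2 * (U ^+ 2 + V ^+ 2) <= P ^+ 2 + Q ^+ 2.
  by rewrite PQ UV tE; nra.
by lra.
Qed.

(** If [|f(e)| >= eps] there is nothing to perturb.  Otherwise [|f(e)| < |s|], so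
the two terms of [f(e) + s] cannot cancel, while [e + s fs] keeps norm at most
1. *)
Lemma perturbation_nonarch f e fs (s : k) : ~ archimedean k -> 0 < eps ->
    vnorm e = 1 -> vnorm fs = 1 -> dot f fs = 1 ->
    eps <= lf_abs s -> lf_abs s <= 1 ->
  exists2 s' : k, lf_abs s' <= lf_abs s &
    eps * vnorm (e + s' *: fs) <= lf_abs (dot f (e + s' *: fs)).
Proof.
move=> na eps0 e1 fs1 ffs s_eps s1.
have [fe|fe] := lerP eps (lf_abs (dot f e)).
  exists 0; first by rewrite lf_abs0 lf_abs_ge0.
  by rewrite scale0r addr0 e1 mulr1.
exists s => //; rewrite dotDr dotZr ffs mulr1.
have fes : lf_abs s <= lf_abs (dot f e + s).
  have := lf_absB_max na (dot f e + s) (dot f e).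
  rewrite [_ + s]addrC addrK le_max => /orP[//|s_fe].
  by have := le_lt_trans (le_trans s_eps s_fe) fe; rewrite ltxx.
apply: le_trans fes; apply: le_trans s_eps.
rewrite ler_piMr ?(ltW eps0)//; apply: le_trans (vnormD_max na _ _) _.
by rewrite vnormZ e1 fs1 mulr1 ge_max lexx.
Qed.

End Perturbation.

Lemma exists_power_between (R : realType) (x eps : R) :
  0 < x -> x < 1 -> 0 < eps -> eps <= 1 ->
  exists m, eps <= x ^+ m /\ x ^+ m.+1 < eps.
Proof.
move=> x0 x1 eps0 eps1.
have bernoulli (d : R) m : 0 <= d -> 1 + d * m%:R <= (1 + d) ^+ m.
  move=> d0; elim: m => [|m IH]; first by rewrite mulr0 addr0 expr0.
  rewrite exprS mulrS; have m0 : 0 <= m%:R :> R by [].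
  by apply: le_trans (ler_wpM2l _ IH); nra.
have ex : exists m, x ^+ m < eps.
  pose d := x^-1 - 1.
  have d0 : 0 < d by rewrite subr_gt0 invf_gt1.
  pose m := Num.bound (eps^-1 / d); exists m.
  have : eps^-1 / d < m%:R by apply: archi_boundP; rewrite divr_ge0// ?invr_ge0 ltW.
  rewrite ltr_pdivrMr// => md.
  have := bernoulli d m (ltW d0); rewrite [1 + d](_ : _ = x^-1) ?exprVn; last by rewrite /d addrC subrK.
  move=> le_m.
  rewrite -ltf_pV2 ?posrE ?exprn_gt0//.
  by apply: lt_le_trans le_m; rewrite (lt_trans md)// mulrC ltrDr.
have [[|m] mP m_min] := ex_minnP ex.
  by move: mP; rewrite expr0 ltNge eps1.
exists m; split=> //; rewrite leNgt; apply/negP => /m_min.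
by rewrite ltnn.
Qed.

Lemma uniformizer_abs (R : realType) (k : localField R) (pi : k) :
  uniformizer pi -> 0 < lf_abs pi /\ lf_abs pi < 1.
Proof.
move=> [pi0 piP]; split; first by rewrite lf_abs_gt0.
by apply/piP; exists 1; rewrite ?mul1r ?lf_abs1.
Qed.

Section DiagonalContraction.
Variables (R : realType) (k : localField R) (n : nat) (eps : R).
Variables (a : 'rV[k]_n) (i1 i2 : 'I_n) (f w : 'cV[k]_n).
Hypotheses (eps_gt0 : 0 < eps) (eps_lt1 : eps < 1) (i12 : i1 != i2) (a1_neq0 : a 0 i1 != 0).
Hypothesis a_le : forall i, lf_abs (a 0 i) <= lf_abs (a 0 i1).
Hypotheses (f_neq0 : f != 0) (fw : contracting_form eps (diag_mx a) f w).

(** [f'] is [f] normalized, and the distance of [u] to the kernel of [f'] is at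
least [|f'(u)|].  The form [phi] is chosen to vanish at [w], so that
[|phi(x)|] bounds from below the distance of [x] to the line of [w].  Its
support is in the coordinates [i1] and [i2], which makes it see these two
entries of [a] only. *)
Lemma diagonal_dual_forms :
  exists f' fs phi : 'cV[k]_n,
    [/\ [/\ vnorm fs = 1, dot f' fs = 1 & vnorm phi = 1],
        forall j, j != i1 -> j != i2 -> phi j 0 = 0,
        vnorm (diag_mx a *m fs) <= lf_abs (a 0 i1),
        lf_abs (dot phi (diag_mx a *m fs)) <= eps * lf_abs (a 0 i1) &
        forall u, eps * vnorm u <= lf_abs (dot f' u) ->
          lf_abs (dot phi (diag_mx a *m u)) <= eps * vnorm (diag_mx a *m u)].
Proof.
have [c cf1] := vnorm_normalize f_neq0.
have [fs fs1 ffs] := dual_vector cf1.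
have [phi [phi1 phiw phi_supp]] := orthogonal_form2 w i12.
have near u : eps * vnorm u <= lf_abs (dot (c *: f) u) ->
    lf_abs (dot phi (diag_mx a *m u)) <= eps * vnorm (diag_mx a *m u).
  move=> u_far; have [v fv|d near] := fw (u := u).
    apply: le_trans u_far _.
    have -> : dot (c *: f) u = dot (c *: f) (u - v).
      by rewrite dotBr [dot _ v]dotZl fv mulr0 subr0.
    by apply: le_trans (abs_dot_le _ _) _; rewrite cf1 mul1r.
  apply: le_trans near.
  have -> : dot phi (diag_mx a *m u) = dot phi (diag_mx a *m u - d *: w).
    by rewrite [RHS]dotBr dotZr phiw mulr0 subr0.
  by apply: le_trans (abs_dot_le _ _) _; rewrite phi1 mul1r.
have fs_le : vnorm (diag_mx a *m fs) <= lf_abs (a 0 i1).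
  rewrite -[leRHS]mulr1 -fs1; apply: vnorm_diag_le => //.
  exact: lf_abs_ge0.
exists (c *: f), fs, phi; split=> //.
apply: le_trans (near fs _) _; first by rewrite fs1 ffs lf_abs1 mulr1 ltW.
by rewrite ler_wpM2l ?(ltW eps_gt0).
Qed.

(** With [p], [q] the absolute values of the two coordinates of [phi], [bound] for
[i1] gives [p <= eps + 11/5 eps^2 <= 2/5], whence [q >= 4/5].  Then [bound] for
[i2] gives [(4/5 - 1/4) |a_2| <= 11/5 eps^2 |a_1|], and the constant is
[(11/5) / (11/20) = 4]. *)
Lemma diagonal_ratio_arch : archimedean k -> eps < 4^-1 ->
  lf_abs (a 0 i2) <= 4 * eps ^+ 2 * lf_abs (a 0 i1).
Proof.
move=> ar eps1.
have [f' [fs [phi [[fs1 ffs phi1] phi_supp fs_le phi_fs near]]]] :=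
  diagonal_dual_forms.
set A1 := lf_abs (a 0 i1) in fs_le phi_fs *; set A2 := lf_abs (a 0 i2).
have A10 : 0 < A1 by rewrite lf_abs_gt0.
have bound i : lf_abs (phi i 0) * lf_abs (a 0 i) <=
    eps * (lf_abs (a 0 i) + 11 / 10 * eps * A1) + 11 / 10 * eps * (eps * A1).
  have [s s_le] := perturbation_arch ar eps_gt0 eps1 (vnorm_std_basis k i) fs1 ffs.
  move=> /near; rewrite mulmxDr diag_mul_std_basis -scalemxAr => phi_le.
  have -> : lf_abs (phi i 0) * lf_abs (a 0 i) =
      lf_abs (dot phi (a 0 i *: std_basis i + s *: (diag_mx a *m fs))
              - s * dot phi (diag_mx a *m fs)).
    by rewrite dotDr !dotZr dot_std_basis addrK lf_absM mulrC.
  apply: le_trans (lf_absB _ _) _; rewrite lf_absM; apply: lerD.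
    apply: le_trans phi_le _; rewrite ler_wpM2l ?(ltW eps_gt0)//.
    apply: le_trans (vnormD _ _) _.
    by rewrite !vnormZ vnorm_std_basis mulr1 lerD2l ler_pM ?lf_abs_ge0 ?vnorm_ge0.
  by rewrite ler_pM ?lf_abs_ge0.
have phi_sqr : lf_abs (phi i1 0) ^+ 2 + lf_abs (phi i2 0) ^+ 2 = 1.
  have := coord_norm_arch_sqr (fun i => phi i 0) ar.
  rewrite -/(vnorm phi) phi1 expr1n (bigD1 i1)//= (bigD1 i2)/= 1?eq_sym//.
  by rewrite big1 ?addr0// => j /andP[j1 j2]; rewrite phi_supp// lf_abs0 expr0n.
have := bound i1; have := bound i2; rewrite -/A1 -/A2.
have : A2 <= A1 := a_le i2.
have := lf_abs_ge0 (phi i1 0); have := lf_abs_ge0 (phi i2 0).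
have : 0 <= A2 := lf_abs_ge0 _.
move: phi_sqr; set p := lf_abs (phi i1 0); set q := lf_abs (phi i2 0).
move=> pq A20 q0 p0 A21 bound2 bound1.
have eps2 : eps ^+ 2 <= 4^-1 ^+ 2 by rewrite !expr2 ler_pM// ltW.
have p_le : p <= 2 / 5.
  rewrite -(ler_pM2r A10); apply: le_trans bound1 _.
  have : eps ^+ 2 * A1 <= 4^-1 ^+ 2 * A1 by rewrite ler_pM2r.
  have : eps * A1 <= 4^-1 * A1 by rewrite ler_pM2r// ltW.
  by lra.
have q_ge : 4 / 5 <= q by nra.
have : 4 / 5 * A2 <= q * A2 by rewrite ler_wpM2r.
have : eps * A2 <= 4^-1 * A2 by rewrite ler_wpM2r// ltW.
by lra.
Qed.

(** The estimate for [i1] gives [|phi_1| <= eps < 1], so the maximum defining the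
norm of [phi] is reached at its other coordinate and [|phi_2| = 1] exactly; no
constant is lost. *)
Lemma diagonal_ratio_nonarch (pi : k) : ~ archimedean k -> uniformizer pi ->
  lf_abs (a 0 i2) <= eps ^+ 2 / lf_abs pi * lf_abs (a 0 i1).
Proof.
move=> na /uniformizer_abs[pi0 pi1].
have [f' [fs [phi [[fs1 ffs phi1] phi_supp fs_le phi_fs near]]]] :=
  diagonal_dual_forms.
set A1 := lf_abs (a 0 i1) in fs_le phi_fs *; set A2 := lf_abs (a 0 i2).
have A10 : 0 < A1 by rewrite lf_abs_gt0.
have [m [m_ge m_lt]] := exists_power_between pi0 pi1 eps_gt0 (ltW eps_lt1).
pose d := lf_abs (pi ^+ m); have dE : d = lf_abs pi ^+ m by rewrite /d lf_absX.
have d1 : d <= 1 by rewrite dE exprn_ile1// ltW.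
have d_ge : eps <= d by rewrite dE.
have d0 : 0 <= d by exact: lf_abs_ge0.
have d_pi : d <= eps / lf_abs pi.
  by rewrite ler_pdivlMr// dE -exprSr ltW.
have bound i : lf_abs (phi i 0) * lf_abs (a 0 i) <=
    Num.max (eps * lf_abs (a 0 i)) (eps * (d * A1)).
  have [s s_le] :=
    perturbation_nonarch na eps_gt0 (vnorm_std_basis k i) fs1 ffs d_ge d1.
  move=> /near; rewrite mulmxDr diag_mul_std_basis -scalemxAr => phi_le.
  have -> : lf_abs (phi i 0) * lf_abs (a 0 i) =
      lf_abs (dot phi (a 0 i *: std_basis i + s *: (diag_mx a *m fs))
              - s * dot phi (diag_mx a *m fs)).
    by rewrite dotDr !dotZr dot_std_basis addrK lf_absM mulrC.
  apply: le_trans (lf_absB_max na _ _) _; rewrite lf_absM ge_max; apply/andP; split.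
    apply: le_trans phi_le _; rewrite -maxr_pMr ?(ltW eps_gt0)//.
    rewrite ler_wpM2l ?(ltW eps_gt0)//.
    apply: le_trans (vnormD_max na _ _) _.
    rewrite !vnormZ vnorm_std_basis mulr1 ge_max !le_max lexx/=.
    by apply/orP; right; rewrite ler_pM ?lf_abs_ge0 ?vnorm_ge0.
  by rewrite le_max; apply/orP; right; rewrite mulrCA ler_pM ?lf_abs_ge0.
have phi_i1 : lf_abs (phi i1 0) < 1.
  apply: le_lt_trans eps_lt1; rewrite -(ler_pM2r A10).
  apply: le_trans (bound i1) _; rewrite -/A1 ge_max lexx/= ler_wpM2l ?(ltW eps_gt0)//.
  by rewrite ler_piMl// ltW.
have phi_i2 : lf_abs (phi i2 0) = 1.
  have [|j phij] := @coord_norm_nonarch_attained _ _ _ (fun i => phi i 0) na.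
    by rewrite -/(vnorm phi) phi1.
  move: phij; rewrite -/(vnorm phi) phi1 => phij.
  have [j1|j1] := eqVneq j i1; first by move: phi_i1; rewrite -j1 -phij ltxx.
  have [<-//|j2] := eqVneq j i2.
  by move/eqP: phij; rewrite phi_supp// lf_abs0 oner_eq0.
(* The first term of the maximum cannot bound [A2] unless [A2 = 0], as [eps < 1]. *)
have := bound i2; rewrite phi_i2 mul1r -/A2 le_max => /orP[A2_le|A2_le].
  have eps' : 0 < 1 - eps by rewrite subr_gt0.
  apply: (@le_trans _ _ 0).
    by rewrite -(pmulr_rle0 _ eps') mulrBl mul1r subr_le0.
  by rewrite mulr_ge0 ?divr_ge0 ?sqr_ge0 ?ltW.
apply: le_trans A2_le _; rewrite mulrA ler_wpM2r ?(ltW A10)//.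
by rewrite expr2 -mulrA ler_wpM2l ?(ltW eps_gt0).
Qed.

End DiagonalContraction.

Theorem proposition5 (R : realType) (k : localField R) (n : nat)
    (hn : (2 <= n)%N) (g : 'M[k]_n) (hg : g \in unitmx)
    (eps : R) (eps_gt0 : 0 < eps) (eps_lt : eps < 4^-1)
    (kg : 'M[k]_n) (a : 'rV[k]_n) (kg' : 'M[k]_n)
    (hcartan : cartan_decomposition g kg a kg') :
  let i1 : 'I_n := Ordinal (ltnW hn) in
  let i2 : 'I_n := Ordinal hn in
  (lf_abs (a 0 i2 / a 0 i1) <= eps ^+ 2 ->
     contracting eps g /\
     contracting_with eps g
       <<[seq invmx kg' *m std_basis i | i : 'I_n <- enum 'I_n & (0 < i)%N]>>%VS
       <[kg *m std_basis i1]>%VS)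
  /\
  (contracting eps g ->
     (~ archimedean k -> forall pi : k, uniformizer pi ->
        lf_abs (a 0 i2 / a 0 i1) <= eps ^+ 2 / lf_abs pi) /\
     (archimedean k -> lf_abs (a 0 i2 / a 0 i1) <= 4 * eps ^+ 2)).
Proof.
move=> i1 i2; split=> [ratio|contr].
  have gP := cartan_contracting_with hg eps_gt0 hcartan ratio.
  by split=> //; do 2 eexists; exact: gP.
have a0 := cartan_diag_neq0 hg hcartan.
have [f [w [f0 gP]]] := contracting_exists_form hn hg contr.
have aP := cartan_contracting_form hcartan gP.
have [_ [kgU' _] _ a_mono _] := hcartan.
have f0' : (invmx kg')^T *m f != 0.
  have tU : (invmx kg')^T \in unitmx by rewrite unitmx_tr unitmx_inv.
  by apply: contra_neq f0 => f'0; rewrite -(mulKmx tU f) f'0 mulmx0.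
have a_le i : lf_abs (a 0 i) <= lf_abs (a 0 i1) by apply: a_mono.
have i12 : i1 != i2 by [].
have eps_lt1 : eps < 1 by lra.
split=> [na pi piP|ar]; rewrite lf_absM lf_absV ler_pdivrMr ?lf_abs_gt0//.
  exact: (diagonal_ratio_nonarch eps_gt0 eps_lt1 i12 (a0 i1) a_le f0' aP na piP).
exact: (diagonal_ratio_arch eps_gt0 eps_lt1 i12 (a0 i1) a_le f0' aP ar eps_lt).
Qed.
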